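(* Let $n$ be a positive integer and $q=(q_1,\ldots,q_{d-1},n)\in\mathbb{Z}^d$, and set $q_d=1-\sum_{j=1}^{d-1}q_j$. Assume $q_i\mid n$ for all $i=1,\ldots,d$. For a positive integer $m$ let $q^{(m)}=(q_1,\ldots,q_{d-1},mn)$. Then there exist unique polynomials $L_1(x),L_2(x)$ (not depending on $m$) such that $$h^*_{\Delta(0,q^{(m)})}(x)=mx\,L_1(x)+L_2(x)\quad\text{for all positive integers } m,$$ namely $$L_1(x)=\sum_{j=0}^{n-1}x^{\left\lceil\frac{q_1j+q_1^+}{n}\right\rceil+\cdots+\left\lceil\frac{q_dj+q_d^+}{n}\right\rceil-1},\qquad L_2(x)=h^*_{\Delta(0,q)}(x)-\sum_{j=0}^{n-1}x^{\left\lceil\frac{q_1j+q_1^+}{n}\right\rceil+\cdots+\left\lceil\frac{q_dj+q_d^+}{n}\right\rceil}.$$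
   Context: For integer $a$, $a^+=\max(0,a)$. For $p=(p_1,\ldots,p_{d-1},N)\in\mathbb{Z}^d$ with $N\neq0$, $\Delta(0,p)=\mathrm{conv}\{\mathbf{0},\mathbf{e}_1,\ldots,\mathbf{e}_{d-1},N\mathbf{e}_d+\sum_{i=1}^{d-1}p_i\mathbf{e}_i\}\subset\mathbb{R}^d$, where $\mathbf{e}_i$ are the unit coordinate vectors and $\mathbf{0}$ the origin. For a $d$-dimensional integral polytope $\mathcal{P}$ with Ehrhart polynomial $i(\mathcal{P},t)=\#(t\mathcal{P}\cap\mathbb{Z}^d)$, the $h^*$-polynomial is defined by $1+\sum_{t\geq1}i(\mathcal{P},t)x^t=h^*_{\mathcal{P}}(x)/(1-x)^{d+1}$. *)

(* Defs.v *)
From HB Require Import structures.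
From mathcomp Require Import all_boot all_order all_algebra.
From mathcomp Require Import finmap all_classical all_reals.

Set Implicit Arguments.
Unset Strict Implicit.
Unset Printing Implicit Defensive.

Import Order.TTheory GRing.Theory Num.Theory.

Local Open Scope classical_set_scope.
Local Open Scope ring_scope.

Definition conv (R : realType) (V : lmodType R) (s : seq V) : set V :=
  [set x | exists w : 'I_(size s) -> R,
     [/\ forall i, 0 <= w i, \sum_i w i = 1 & x = \sum_i w i *: s`_i]].

Definition dilate (R : realType) (V : lmodType R) (t : nat) (P : set V) :
    set V :=
  [set t%:R *: x | x in P].

(* i(P, t); [fset_set] of an infinite set is empty, but t P is bounded for a
   polytope P. *)
Definition ehrhart (R : realType) (d : nat) (P : set 'rV[R]_d) (t : nat) :
    nat :=
  #|` fset_set [set z : 'rV[int]_d | dilate t P (map_mx intr z)] |.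

(* Formal power series are represented by their coefficient sequences. *)
Definition ehrhart_series (R : realType) (d : nat) (P : set 'rV[R]_d) :
    nat -> R :=
  fun t => if t == 0%N then 1 else (ehrhart P t)%:R.

Definition series_mul (R : realType) (f g : nat -> R) : nat -> R :=
  fun k => \sum_(i < k.+1) f i * g (k - i)%N.

(* Ehr_P(x) = h(x) / (1 - x)^(d+1), with the denominator cleared. *)
Definition is_hstar (R : realType) (d : nat) (P : set 'rV[R]_d)
    (h : {poly R}) : Prop :=
  forall k : nat,
    series_mul (ehrhart_series P) (fun i => ((1 - 'X) ^+ d.+1 : {poly R})`_i) k
    = h`_k.

Definition hstar (R : realType) (d : nat) (P : set 'rV[R]_d) : {poly R} :=
  xget 0 (is_hstar P).

Lemma hstar_eq (R : realType) (d : nat) (P : set 'rV[R]_d) (h : {poly R}) :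
  is_hstar P h -> hstar P = h.
Proof.
move=> Ph; have /= Pg := xgetPex 0 (ex_intro (is_hstar P) h Ph).
by apply/polyP => k; rewrite /hstar -Pg -Ph.
Qed.

(* The dimension is d = k.+1; the last coordinate of p is N, so that
   N e_d + sum_(i < d) p_i e_i is p itself. *)
Definition Delta0 (R : realType) (k : nat) (p : 'rV[int]_k.+1) :
    set 'rV[R]_k.+1 :=
  conv (0 :: rcons [seq delta_mx 0 (lift ord_max i) | i <- enum 'I_k]
                   (map_mx intr p)).

Definition extend_last (k : nat) (q : 'I_k -> int) (a : int) :
    'I_k.+1 -> int :=
  fun i => if unlift ord_max i is Some j then q j else a.

(* (q_1, ..., q_(d-1), N) *)
Definition qvec (k : nat) (q : 'I_k -> int) (N : nat) : 'rV[int]_k.+1 :=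
  \row_i extend_last q N%:Z i.

(* (q_1, ..., q_d) with q_d = 1 - (q_1 + ... + q_(d-1)) *)
Definition qfull (k : nat) (q : 'I_k -> int) : 'I_k.+1 -> int :=
  extend_last q (1 - \sum_j q j).

Definition pos_part (a : int) : int := Num.max 0 a.

Definition expo (k : nat) (q : 'I_k -> int) (n j : nat) : int :=
  \sum_(i < k.+1)
    Num.ceil (((qfull q i * j%:Z + pos_part (qfull q i))%:~R : rat) / n%:R).

Lemma sum_qfull (k : nat) (q : 'I_k -> int) : \sum_i qfull q i = 1.
Proof.
rewrite big_ord_recr /= /qfull /extend_last unlift_none addrC.
suff -> : \sum_(i < k) (if unlift ord_max (widen_ord (leqnSn k) i) is Some j
   then q j else 1 - \sum_j q j) = \sum_j q j by rewrite subrK.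
apply: eq_bigr => i _.
have -> : widen_ord (leqnSn k) i = lift ord_max i.
  by apply: val_inj; rewrite /= /bump leqNgt ltn_ord.
by rewrite liftK.
Qed.

(* Hence the absolute values in the exponents of [L1] and [L2] below are
   only casts from int to nat. *)
Lemma expo_gt0 (k : nat) (q : 'I_k -> int) (n j : nat) :
  (0 < n)%N -> 0 < expo q n j.
Proof.
move=> n0; rewrite -(ltr0z rat) /expo rmorph_sum /=.
apply: (@lt_le_trans _ _ (\sum_(i < k.+1)
  (((qfull q i * j%:Z + pos_part (qfull q i))%:~R : rat) / n%:R))); last first.
  by apply: ler_sum => i _; exact: ceil_ge.
rewrite -mulr_suml divr_gt0 ?ltr0n // -rmorph_sum /= ltr0z.
rewrite big_split /= -mulr_suml sum_qfull mul1r.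
apply: (@lt_le_trans _ _ (\sum_i qfull q i)); first by rewrite sum_qfull.
rewrite ler_wpDl //; apply: ler_sum => i _.
by rewrite /pos_part le_max lexx orbT.
Qed.

Definition L1 (R : realType) (k : nat) (q : 'I_k -> int) (n : nat) : {poly R} :=
  \sum_(0 <= j < n) 'X^(`|(expo q n j - 1)%R|%N).

Definition L2 (R : realType) (k : nat) (q : 'I_k -> int) (n : nat) : {poly R} :=
  hstar (@Delta0 R k (qvec q n)) - \sum_(0 <= j < n) 'X^(`|expo q n j|%N).

(* Main.v *)
Require Import Defs.
From mathcomp Require Import all_boot all_order all_algebra.
From mathcomp Require Import finmap all_classical all_reals.
From mathcomp Require Import zify ring.

(** Fix N > 0, let q_d = 1 - (q_1 + ... + q_(d-1)) and let c(a) be the sum of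
    the ceilings of q_i a / N over i <= d.  In t Delta(0, (q, N)), the points x
    with last coordinate a >= 0 are cut out by x_i >= q_i a / N for i < d and
    t - (x_1 + ... + x_(d-1)) >= q_d a / N, so rounding up gives a lattice point
    (x, t) of the cone over Delta(0, (q, N)) at height t = c(a).
    Every lattice point of the cone is obtained in a unique way by translating
    one of these, with 0 <= a < N, along the d + 1 generators of the cone, which
    all have height 1.  Hence h* is the sum over a < N of x^c(a).
    For N = m n write a = j m + r with r < m: the terms with r = 0 give the
    h*-polynomial for n, and since q_i divides n, every term with r > 0 has the
    exponent occurring in L_1 and L_2, whatever r is. *)

Set Implicit Arguments.
Unset Strict Implicit.
Unset Printing Implicit Defensive.

Import Order.TTheory GRing.Theory Num.Theory.

Local Open Scope ring_scope.

Lemma exists_extend_ord (T : Type) (n : nat) (h : 'I_n.+1) (a : T)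
    (f : 'I_n -> T) :
  exists2 g : 'I_n.+1 -> T, g h = a & forall i, g (lift h i) = f i.
Proof.
exists (fun i => oapp f a (unlift h i)); first by rewrite unlift_none.
by move=> i; rewrite liftK.
Qed.

Lemma lez_mulDl_lt (x j : int) (m r : nat) :
  (0 < r <= m)%N -> (j * m%:Z + r%:Z <= x * m%:Z) = (j < x).
Proof. by move=> /andP[r_gt0 le_rm]; apply/idP/idP; nia. Qed.

Lemma lez_mulDr_le (x j : int) (m r : nat) :
  (r < m)%N -> (x * m%:Z <= j * m%:Z + r%:Z) = (x <= j).
Proof. by move=> lt_rm; apply/idP/idP; nia. Qed.

Lemma mulrnDr_inj (V : zmodType) (A B A' B' : V) :
  (forall m, (0 < m)%N -> A *+ m + B = A' *+ m + B') -> A = A' /\ B = B'.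
Proof.
move=> eqAB; have eqA : A = A'.
  have := eqAB 2 isT; rewrite !mulrS !mulr0n !addr0 -!addrA.
  by have := eqAB 1 isT; rewrite !mulr1n => -> /addIr.
by split=> //; have := eqAB 1 isT; rewrite eqA => /addrI.
Qed.

Definition ceil_div (b : int) (N : nat) : int :=
  Num.ceil ((b%:~R : rat) / N%:R).

Lemma ceil_div0 (N : nat) : ceil_div 0 N = 0.
Proof. by rewrite /ceil_div mul0r ceil0. Qed.

Lemma ceil_div_le (b : int) (N : nat) (z : int) :
  (0 < N)%N -> (ceil_div b N <= z) = (b <= z * N%:Z).
Proof.
move=> N_gt0; rewrite /ceil_div ceil_le_int ler_pdivrMr ?ltr0n //.
by rewrite pmulrn -intrM ler_int.
Qed.

Lemma ceil_div_ge (b : int) (N : nat) :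
  (0 < N)%N -> b <= ceil_div b N * N%:Z.
Proof. by move=> N_gt0; rewrite -ceil_div_le. Qed.

Lemma ceil_div_ext (b c : int) (M N : nat) : (0 < M)%N -> (0 < N)%N ->
  (forall z, (b <= z * M%:Z) = (c <= z * N%:Z)) -> ceil_div b M = ceil_div c N.
Proof.
move=> M_gt0 N_gt0 eq_le; apply/le_anti.
by rewrite ceil_div_le // eq_le -ceil_div_le // lexx ceil_div_le // -eq_le
  -ceil_div_le // lexx.
Qed.

Lemma ceil_divDM (b c : int) (N : nat) :
  (0 < N)%N -> ceil_div (b + c * N%:Z) N = ceil_div b N + c.
Proof.
move=> N_gt0; have N_neq0 : N%:R != 0 :> rat by rewrite pnatr_eq0 -lt0n.
by rewrite /ceil_div intrD intrM mulrDl mulfK // ceilDrz ?intrKceil.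
Qed.

Lemma ceil_divMM (b : int) (m N : nat) :
  (0 < m)%N -> (0 < N)%N -> ceil_div (b * m%:Z) (m * N) = ceil_div b N.
Proof.
move=> m_gt0 N_gt0; apply: ceil_div_ext; rewrite ?muln_gt0 ?m_gt0 // => z.
by rewrite PoszM [m%:Z * _]mulrC mulrA ler_pM2r.
Qed.

(* With n = s c the two quotients are (j + r / m) / s and (j + [c > 0]) / s;
   rounding up only sees the ceiling (c > 0) or the floor (c < 0) of j + r/m. *)
Lemma ceil_div_block (c : int) (n m j r : nat) :
  (0 < n)%N -> (c %| n%:Z)%Z -> (0 < r < m)%N ->
  ceil_div (c * (j * m + r)%:Z) (m * n) = ceil_div (c * j%:Z + pos_part c) n.
Proof.
move=> n_gt0 /dvdzP[s n_sc] /andP[r_gt0 lt_rm].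
have m_gt0 := ltn_trans r_gt0 lt_rm.
apply: ceil_div_ext => // [|z]; first by rewrite muln_gt0 m_gt0.
have -> : z * (m * n)%:Z = c * (z * s * m%:Z) by rewrite PoszM n_sc; ring.
have -> : z * n%:Z = c * (z * s) by rewrite n_sc; ring.
rewrite PoszD PoszM /pos_part; case: (ltrgt0P c) => c_sign.
- rewrite (_ : c * j%:Z + c = c * (j%:Z + 1)); last by rewrite mulrDr mulr1.
  by rewrite !ler_pM2l // lez_mulDl_lt ?r_gt0 ?(ltnW lt_rm) // lezD1.
- by rewrite addr0 !ler_nM2l // lez_mulDr_le.
- by move: n_gt0; rewrite -ltz_nat n_sc c_sign mulr0 ltxx.
Qed.

Lemma expr_1subX_mul_bin_poly (R : comNzRingType) (d K : nat) :
  exists Q : {poly R},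
    (1 - 'X) ^+ d.+1 * \poly_(i < K) ('C(d + i, d)%:R) = 1 - 'X^K * Q.
Proof.
elim: d => [|d [Q IHd]].
  exists 1; rewrite mulr1 expr1 poly_def.
  under eq_bigr do rewrite bin0 scale1r.
  by apply: oppr_inj; rewrite -mulNr !opprB -subrX1.
pose c : R := 'C(d + K, d.+1)%:R.
have pascal : (1 - 'X) * \poly_(i < K) ('C(d.+1 + i, d.+1)%:R)
    = \poly_(i < K) ('C(d + i, d)%:R) - 'X^K * c%:P :> {poly R}.
  apply/polyP => i; rewrite mulrBl mul1r !coefB coefXM !coef_poly coefXnM coefC.
  case: i => [|i] /=.
    by rewrite subr0 !addn0 !binn /c; case: (posnP K) => [->|_];
      rewrite ?addn0 ?bin_small ?subr0.
  rewrite subn_eq0 addSnnS; case: (ltngtP i.+1 K) => [lt_iK|lt_Ki|eq_iK].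
  - by rewrite addnS binS natrD addSnnS addrC addKr subr0.
  - by rewrite !subr0.
  - by rewrite /c -eq_iK addSnnS.
exists (Q + (1 - 'X) ^+ d.+1 * c%:P).
by rewrite exprSr -mulrA pascal mulrBr IHd; ring.
Qed.

Lemma is_hstar_sum_Xn (R : realType) (d : nat) (P : set 'rV[R]_d) (I : finType)
    (h : I -> nat) :
  (forall t, ehrhart_series P t
     = (\sum_(i | (h i <= t)%N) 'C(d + (t - h i), d))%N%:R) ->
  is_hstar P (\sum_i 'X^(h i)).
Proof.
move=> seriesP K; set H := \sum_i _.
pose B : {poly R} := \poly_(i < K.+1) ('C(d + i, d)%:R).
have seriesE t : (t <= K)%N -> ehrhart_series P t = (H * B)`_t.
  move=> le_tK; rewrite seriesP mulr_suml coef_sum natr_sum big_mkcond /=.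
  apply: eq_bigr => i _; rewrite coefXnM ltnNge coef_poly.
  case: (leqP (h i) t) => //= _.
  by rewrite ltnS (leq_trans (leq_subr _ _) le_tK).
transitivity (H * B * (1 - 'X) ^+ d.+1)`_K.
  rewrite coefM; apply: eq_bigr => -[i /=]; rewrite ltnS => le_iK _.
  by rewrite seriesE.
have [Q BQ] := expr_1subX_mul_bin_poly R d K.+1.
by rewrite -mulrA [B * _]mulrC BQ mulrBr mulr1 mulrCA coefB coefXnM ltnSn subr0.
Qed.

Lemma card_tuple_ord_sum_le (m n M : nat) : (n <= M)%N ->
  #|[set u : m.-tuple 'I_M.+1 | \sum_(i <- u) i <= n]%N| = 'C(m + n, m).
Proof.
move=> le_nM; rewrite -card_partial_ord_partitions.
pose widen (u : m.-tuple 'I_n.+1) :=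
  map_tuple (widen_ord (le_nM : n < M.+1)%N) u.
have widen_inj : injective widen.
  move=> u v eq_uv; apply: eq_from_tnth => i; apply/val_inj.
  by have := congr1 (fun w => val (tnth w i)) eq_uv; rewrite !tnth_map.
rewrite -(card_imset _ widen_inj); congr #|pred_of_set _|.
apply/setP => u; rewrite inE; apply/idP/imsetP => [sum_u|[v + ->]]; last first.
  by rewrite inE big_map.
have u_le i : (tnth u i < n.+1)%N.
  by rewrite ltnS (leq_trans _ sum_u) // big_tuple (bigD1 i) //= leq_addr.
have uE : u = widen [tuple Ordinal (u_le i) | i < m].
  by apply: eq_from_tnth => i; rewrite tnth_map tnth_mktuple; apply: val_inj.
exists [tuple Ordinal (u_le i) | i < m] => //.
by rewrite inE; move: sum_u; rewrite {1}uE big_map.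
Qed.

Lemma card_pair_tuple_sum_le (I : finType) (h : I -> nat) (m t : nat) :
  #|[pred p : I * m.-tuple 'I_t.+1 | h p.1 + \sum_(j <- p.2) j <= t]%N|
  = (\sum_(i | h i <= t) 'C(m + (t - h i), m))%N.
Proof.
set P := [pred p | _].
rewrite -sum1_card.
rewrite -(pair_big_dep predT (fun i u => P (i, u)) (fun _ _ => 1%N)) /=.
rewrite [RHS]big_mkcond /=; apply: eq_bigr => i _; case: leqP => le_ht.
  rewrite -(card_tuple_ord_sum_le _ (leq_subr (h i) t)) sum1dep_card.
  by congr #|pred_of_set _|; apply/setP => u; rewrite !inE leq_subRL ?big_tuple.
by rewrite big_pred0 // => u; rewrite leqNgt ltn_addr.
Qed.

Lemma conv_cons0 (R : realType) (V : lmodType R) (n : nat) (s : seq V) (x : V) :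
  size s = n ->
  conv (0 :: s) x <-> exists w : 'I_n -> R,
    [/\ forall i, 0 <= w i, \sum_i w i <= 1 & x = \sum_i w i *: s`_i].
Proof.
move=> <-; split=> [[w [w_ge0 w_sum ->]]|[w [w_ge0 w_sum ->]]].
  exists (w \o lift ord0); split=> [i||]; first exact: w_ge0.
    by rewrite -w_sum big_ord_recl lerDr.
  by rewrite big_ord_recl scaler0 add0r.
have [u u0 u_lift] := exists_extend_ord ord0 (1 - \sum_j w j) w.
exists u; split=> [i||].
- by case: (unliftP ord0 i) => [j|] ->; rewrite ?u_lift // u0 subr_ge0.
- by rewrite big_ord_recl u0 (eq_bigr _ (fun i _ => u_lift i)) subrK.
- by rewrite big_ord_recl scaler0 add0r; apply: eq_bigr => i _; rewrite u_lift.
Qed.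

Lemma dilate_conv_cons0 (R : realType) (V : lmodType R) (n t : nat)
    (s : seq V) (x : V) : size s = n -> (0 < t)%N ->
  dilate t (conv (0 :: s)) x <-> exists w : 'I_n -> R,
    [/\ forall i, 0 <= w i, \sum_i w i <= t%:R & x = \sum_i w i *: s`_i].
Proof.
move=> size_s t_gt0; have tR_gt0 : 0 < t%:R :> R by rewrite ltr0n.
split=> [[y /(conv_cons0 _ size_s)[w [w_ge0 w_sum ->]] <-]|].
  exists (fun i => t%:R * w i); split=> [i||]; first by rewrite mulr_ge0 // ltW.
    by rewrite -mulr_sumr ger_pMr.
  by rewrite scaler_sumr; apply: eq_bigr => i _; rewrite scalerA.
move=> [w [w_ge0 w_sum ->]]; exists (\sum_i (t%:R^-1 * w i) *: s`_i).
  apply/(conv_cons0 _ size_s); exists (fun i => t%:R^-1 * w i); split=> // [i|].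
    by rewrite mulr_ge0 // invr_ge0 ltW.
  by rewrite -mulr_sumr ler_pdivrMl // mulr1.
rewrite scaler_sumr; apply: eq_bigr => i _.
by rewrite scalerA mulrA divff ?mul1r // gt_eqF.
Qed.

Lemma ehrhart_card (R : realType) (d : nat) (P : set 'rV[R]_d) (t : nat)
    (I : finType) (A : pred I) (f : I -> 'rV[int]_d) :
  injective f ->
  (forall z, dilate t P (map_mx intr z) <-> exists2 i, A i & z = f i) ->
  ehrhart P t = #|A|.
Proof.
move=> f_inj tPE; rewrite /ehrhart.
rewrite (_ : [set z | _]%classic = [set` [fset f i | i in A]%fset]%classic).
  by rewrite set_fsetK card_imfset // cardE.
apply/predeqP => z /=; rewrite tPE; split=> [[i Ai ->]|/imfsetP[i Ai ->]].
  by apply/imfsetP; exists i.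
by exists i.
Qed.

Section DilatedSimplex.
Variables (R : realType) (k : nat) (p : 'rV[int]_k.+1).

Definition vertices : seq 'rV[R]_k.+1 :=
  rcons [seq delta_mx 0 (lift ord_max i) | i <- enum 'I_k] (map_mx intr p).

Lemma size_vertices : size vertices = k.+1.
Proof. by rewrite size_rcons size_map size_enum_ord. Qed.

Lemma sum_verticesE (w : 'I_k.+1 -> R) : \sum_i w i *: vertices`_i
  = \sum_(i < k) w (lift ord_max i) *: delta_mx 0 (lift ord_max i)
    + w ord_max *: map_mx intr p.
Proof.
rewrite (bigD1_ord ord_max) // [RHS]addrC; congr (_ + _).
  by rewrite nth_rcons size_map size_enum_ord ltnn eqxx.
apply: eq_bigr => i _; congr (_ *: _); rewrite lift_max.
rewrite nth_rcons size_map size_enum_ord ltn_ord.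
by rewrite (nth_map i) ?size_enum_ord // nth_ord_enum.
Qed.

Lemma sum_vertices_lift (w : 'I_k.+1 -> R) (i : 'I_k) :
  (\sum_i w i *: vertices`_i) 0 (lift ord_max i)
  = w (lift ord_max i) + w ord_max * (p 0 (lift ord_max i))%:~R.
Proof.
rewrite sum_verticesE !mxE summxE (bigD1 i) //= !mxE !eqxx mulr1.
rewrite big1 ?addr0 // => j j_neqi.
by rewrite !mxE /= (inj_eq lift_inj) eq_sym (negPf j_neqi) mulr0.
Qed.

Lemma sum_vertices_max (w : 'I_k.+1 -> R) :
  (\sum_i w i *: vertices`_i) 0 ord_max = w ord_max * (p 0 ord_max)%:~R.
Proof.
rewrite sum_verticesE !mxE summxE big1 ?add0r // => j _.
by rewrite !mxE /= (negPf (neq_lift _ _)) mulr0.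
Qed.

(* The weights w of x are w_d = x_d / p_d and w_i = x_i - p_i w_d. *)
Lemma dilate_Delta0_facets (t : nat) (x : 'rV[R]_k.+1) :
  0 < p 0 ord_max -> (0 < t)%N ->
  dilate t (Delta0 p) x <->
  [/\ 0 <= x 0 ord_max,
      forall i : 'I_k, (p 0 (lift ord_max i))%:~R * x 0 ord_max
        <= x 0 (lift ord_max i) * (p 0 ord_max)%:~R
    & (1 - \sum_(i < k) (p 0 (lift ord_max i))%:~R) * x 0 ord_max
      <= (t%:R - \sum_(i < k) x 0 (lift ord_max i)) * (p 0 ord_max)%:~R].
Proof.
rewrite -(ltr0z R); set N : R := (p 0 ord_max)%:~R => N_gt0 t_gt0.
rewrite (dilate_conv_cons0 _ size_vertices t_gt0).
have slackE (v : R) (w : 'I_k -> R) :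
    ((1 - \sum_(i < k) (p 0 (lift ord_max i))%:~R) * (v * N)
     <= (t%:R - \sum_i (w i + v * (p 0 (lift ord_max i))%:~R)) * N)
    = (v + \sum_i w i <= t%:R).
  rewrite mulrA ler_pM2r // big_split /= -mulr_sumr -subr_ge0 -[RHS]subr_ge0.
  by congr (0 <= _); ring.
split=> [[w [w_ge0 w_sum ->]]|[x_max_ge0 x_lift_ge slack]].
  rewrite sum_vertices_max; split=> [|i|]; first by rewrite mulr_ge0 // ltW.
    by rewrite sum_vertices_lift mulrA ler_pM2r // mulrC lerDr.
  rewrite (eq_bigr _ (fun i _ => sum_vertices_lift w i)) slackE.
  by move: w_sum; rewrite (bigD1_ord ord_max).
pose v := x 0 ord_max / N; have vN : x 0 ord_max = v * N.
  by rewrite divfK // gt_eqF.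
pose w j := x 0 (lift ord_max j) - v * (p 0 (lift ord_max j))%:~R.
have wE j : x 0 (lift ord_max j) = w j + v * (p 0 (lift ord_max j))%:~R.
  by rewrite subrK.
have [u u_max u_lift] := exists_extend_ord ord_max v w.
exists u; split=> [i||].
- case: (unliftP ord_max i) => [j|] ->; last by rewrite u_max divr_ge0 // ltW.
  rewrite u_lift subr_ge0 mulrC.
  by move: (x_lift_ge j); rewrite vN mulrA ler_pM2r.
- rewrite (bigD1_ord ord_max) //= u_max (eq_bigr _ (fun j _ => u_lift j)).
  by move: slack; rewrite vN (eq_bigr _ (fun j _ => wE j)) slackE.
- apply/rowP => i; case: (unliftP ord_max i) => [j ->|->].
    by rewrite sum_vertices_lift u_lift u_max.
  by rewrite sum_vertices_max u_max.
Qed.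

End DilatedSimplex.

Lemma extend_last_lift (k : nat) (q : 'I_k -> int) (a : int) (i : 'I_k) :
  extend_last q a (lift ord_max i) = q i.
Proof. by rewrite /extend_last liftK. Qed.

Lemma extend_last_max (k : nat) (q : 'I_k -> int) (a : int) :
  extend_last q a ord_max = a.
Proof. by rewrite /extend_last unlift_none. Qed.

Lemma qvec_lift (k : nat) (q : 'I_k -> int) (N : nat) (i : 'I_k) :
  qvec q N 0 (lift ord_max i) = q i.
Proof. by rewrite mxE extend_last_lift. Qed.

Lemma qvec_max (k : nat) (q : 'I_k -> int) (N : nat) :
  qvec q N 0 ord_max = N%:Z.
Proof. by rewrite mxE extend_last_max. Qed.

Section LatticePoints.
Variables (k : nat) (q : 'I_k -> int) (N : nat).
Hypothesis N_gt0 : (0 < N)%N.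

Lemma dilate_Delta0_int (R : realType) (t : nat) (z : 'rV[int]_k.+1) :
  (0 < t)%N ->
  dilate t (@Delta0 R k (qvec q N)) (map_mx intr z) <->
  [/\ 0 <= z 0 ord_max,
      forall i, ceil_div (q i * z 0 ord_max) N <= z 0 (lift ord_max i)
    & ceil_div ((1 - \sum_i q i) * z 0 ord_max) N
      <= t%:Z - \sum_(i < k) z 0 (lift ord_max i)].
Proof.
move=> t_gt0; rewrite dilate_Delta0_facets ?qvec_max ?ltz_nat // !mxE ler0z.
have -> : \sum_(i < k) map_mx intr z 0 (lift ord_max i)
    = (\sum_(i < k) z 0 (lift ord_max i))%:~R :> R.
  by rewrite rmorph_sum; apply: eq_bigr => i _; rewrite mxE.
have -> : \sum_(i < k) (qvec q N 0 (lift ord_max i))%:~R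
    = (\sum_i q i)%:~R :> R.
  by rewrite rmorph_sum; apply: eq_bigr => i _; rewrite qvec_lift.
rewrite pmulrn -[X in (X - _) * _ <= _](mulr1z 1) -!intrB -!intrM ler_int.
rewrite ceil_div_le //.
by split=> -[z_max_ge0 z_lift_ge slack]; split=> // i; move: (z_lift_ge i);
  rewrite qvec_lift !mxE -!intrM ler_int ceil_div_le.
Qed.

(* The least t such that t Delta(0, (q, N)) has a lattice point with last
   coordinate [a]. *)
Definition height (a : nat) : nat :=
  `|(\sum_(i < k.+1) ceil_div (qfull q i * a%:Z) N)%R|%N.

Lemma sum_ceil_div_ge (a : nat) :
  a%:Z <= (\sum_(i < k.+1) ceil_div (qfull q i * a%:Z) N) * N%:Z.
Proof.
rewrite -[leLHS]mul1r -(sum_qfull q) !mulr_suml.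
by apply: ler_sum => i _; exact: ceil_div_ge.
Qed.

Lemma heightE (a : nat) :
  (height a)%:Z = \sum_(i < k.+1) ceil_div (qfull q i * a%:Z) N.
Proof.
rewrite gez0_abs // -(@pmulr_lge0 _ N%:Z) //.
exact: le_trans (sum_ceil_div_ge a).
Qed.

Lemma height_split_max (a : nat) : (height a)%:Z
  = ceil_div ((1 - \sum_i q i) * a%:Z) N + \sum_i ceil_div (q i * a%:Z) N.
Proof.
rewrite heightE (bigD1_ord ord_max) //= [qfull _ _]extend_last_max.
congr (_ + _); by apply: eq_bigr => i _; rewrite [qfull _ _]extend_last_lift.
Qed.

Lemma height_eq0 (a : nat) : (height a == 0%N) = (a == 0%N).
Proof.
apply/eqP/eqP => [height_a|->].
  by have := sum_ceil_div_ge a; rewrite -heightE height_a mul0r lez_nat leqn0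
    => /eqP.
by rewrite /height big1 // => i _; rewrite mulr0 ceil_div0.
Qed.

(* [lattice_point a 0] has the least height among the lattice points of the cone
   with last coordinate [a]; [y] counts the translations along the vertices. *)
Definition lattice_point (a : nat) (y : 'I_k.+1 -> nat) : 'rV[int]_k.+1 :=
  \row_i extend_last
    (fun j => ceil_div (q j * a%:Z) N + (y (lift ord_max j))%:Z
              + q j * (y ord_max)%:Z)
    (a%:Z + (y ord_max)%:Z * N%:Z) i.

Lemma lattice_point_lift a y i : lattice_point a y 0 (lift ord_max i)
  = ceil_div (q i * a%:Z) N + (y (lift ord_max i))%:Z + q i * (y ord_max)%:Z.
Proof. by rewrite mxE extend_last_lift. Qed.

Lemma lattice_point_max a y :
  lattice_point a y 0 ord_max = a%:Z + (y ord_max)%:Z * N%:Z.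
Proof. by rewrite mxE extend_last_max. Qed.

Lemma ceil_div_lattice_point a y (c : int) :
  ceil_div (c * lattice_point a y 0 ord_max) N
  = ceil_div (c * a%:Z) N + c * (y ord_max)%:Z.
Proof. by rewrite lattice_point_max mulrDr mulrA ceil_divDM. Qed.

Lemma lattice_point_inj (a b : nat) y y' : (a < N)%N -> (b < N)%N ->
  lattice_point a y = lattice_point b y' -> a = b /\ y =1 y'.
Proof.
move=> lt_aN lt_bN eq_z.
have eq_max : (y ord_max * N + a = y' ord_max * N + b)%N.
  have := congr1 (fun z : 'rV_k.+1 => z 0 ord_max) eq_z.
  rewrite !lattice_point_max -!PoszM -!PoszD => -[].
  by rewrite addnC [RHS]addnC.
have eq_ab : a = b.
  by have := congr1 (modn^~ N) eq_max; rewrite !modnMDl !modn_small.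
have eq_y_max : y ord_max = y' ord_max.
  by have := congr1 (divn^~ N) eq_max; rewrite !divnMDl // !divn_small ?addn0.
split=> // i; case: (unliftP ord_max i) => [j ->|-> //].
have := congr1 (fun z : 'rV_k.+1 => z 0 (lift ord_max j)) eq_z.
by rewrite !lattice_point_lift eq_ab eq_y_max => /addIr /addrI [].
Qed.

Lemma dilate_Delta0_lattice_point (R : realType) (t a : nat) y : (0 < t)%N ->
  dilate t (@Delta0 R k (qvec q N)) (map_mx intr (lattice_point a y)) <->
  (height a + \sum_i y i <= t)%N.
Proof.
move=> t_gt0; rewrite dilate_Delta0_int //.
have slackE : (ceil_div ((1 - \sum_i q i) * lattice_point a y 0 ord_max) N
      <= t%:Z - \sum_i lattice_point a y 0 (lift ord_max i))
    = (height a + \sum_i y i <= t)%N.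
  rewrite -lez_nat PoszD height_split_max (big_morph Posz PoszD erefl).
  rewrite [X in _ + X <= _](bigD1_ord ord_max) //=.
  rewrite [X in _ <= _ - X](eq_bigr _ (fun i _ => lattice_point_lift a y i)).
  rewrite ceil_div_lattice_point !big_split /= -mulr_suml lerBrDr.
  by congr (_ <= _); ring.
rewrite slackE; split=> [[] //|height_le]; split=> // [|i].
  by rewrite lattice_point_max.
by rewrite ceil_div_lattice_point lattice_point_lift lerD2r lerDl.
Qed.

Lemma lattice_point_surj (R : realType) (t : nat) (z : 'rV[int]_k.+1) :
  (0 < t)%N -> dilate t (@Delta0 R k (qvec q N)) (map_mx intr z) ->
  exists2 a, (a < N)%N & exists y, z = lattice_point a y.
Proof.
move=> t_gt0 /dilate_Delta0_int -/(_ t_gt0) [].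
case z_max: (z 0 ord_max) => [b|//] _ z_lift_ge _.
exists (b %% N)%N; first by rewrite ltn_mod.
have [y y_max y_lift] := exists_extend_ord ord_max (b %/ N)%N
  (fun j => `|(z 0 (lift ord_max j) - ceil_div (q j * b%:Z) N)%R|%N).
have z_maxE : lattice_point (b %% N) y 0 ord_max = b%:Z.
  by rewrite lattice_point_max y_max -PoszM -PoszD addnC -divn_eq.
exists y; apply/rowP => i; case: (unliftP ord_max i) => [j ->|->].
  rewrite lattice_point_lift addrAC -ceil_div_lattice_point z_maxE y_lift.
  by rewrite gez0_abs ?subr_ge0 // addrC subrK.
by rewrite z_max z_maxE.
Qed.

Lemma ehrhart_Delta0 (R : realType) (t : nat) : (0 < t)%N ->
  ehrhart (@Delta0 R k (qvec q N)) t
  = (\sum_(a < N | height a <= t) 'C(k.+1 + (t - height a), k.+1))%N.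
Proof.
move=> t_gt0; rewrite -card_pair_tuple_sum_le.
pose point (p : 'I_N * k.+1.-tuple 'I_t.+1) :=
  lattice_point p.1 (val \o tnth p.2).
have pointE p : dilate t (@Delta0 R k (qvec q N)) (map_mx intr (point p)) <->
    (height p.1 + \sum_(j <- p.2) j <= t)%N.
  by rewrite dilate_Delta0_lattice_point // big_tuple.
apply: (ehrhart_card (f := point)).
  move=> [a u] [b v] /lattice_point_inj[] //= /val_inj -> eq_uv; congr (_, _).
  by apply: eq_from_tnth => i; apply/val_inj/eq_uv.
move=> z; split=> [z_in|[p /pointE + ->] //].
have [a lt_aN [y zE]] := lattice_point_surj t_gt0 z_in.
have y_lt i : (y i < t.+1)%N.
  move: z_in; rewrite zE dilate_Delta0_lattice_point // ltnS; apply: leq_trans.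
  by rewrite (bigD1 i) //= addnCA leq_addr.
pose p := (Ordinal lt_aN, [tuple Ordinal (y_lt i) | i < k.+1]).
have pE : z = point p.
  rewrite zE; congr lattice_point; apply/funext => i /=.
  by rewrite tnth_mktuple.
by exists p => //; apply/pointE; rewrite -pE.
Qed.

Lemma ehrhart_series_Delta0 (R : realType) (t : nat) :
  ehrhart_series (@Delta0 R k (qvec q N)) t
  = (\sum_(a < N | height a <= t) 'C(k.+1 + (t - height a), k.+1))%N%:R.
Proof.
rewrite /ehrhart_series; case: posnP => [->|t_gt0]; last first.
  by rewrite ehrhart_Delta0.
rewrite (big_pred1 (Ordinal N_gt0)) ?addn0 ?binn // => a.
by rewrite leqn0 height_eq0.
Qed.

Lemma hstar_Delta0 (R : realType) :
  hstar (@Delta0 R k (qvec q N)) = \sum_(0 <= a < N) 'X^(height a).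
Proof.
rewrite big_mkord; apply/hstar_eq/is_hstar_sum_Xn => t.
exact: ehrhart_series_Delta0.
Qed.

End LatticePoints.

Lemma height_mul (k : nat) (q : 'I_k -> int) (n m j : nat) :
  (0 < n)%N -> (0 < m)%N -> height q (m * n) (j * m) = height q n j.
Proof.
move=> n_gt0 m_gt0; congr absz; apply: eq_bigr => i _.
by rewrite PoszM mulrA ceil_divMM.
Qed.

Lemma height_block (k : nat) (q : 'I_k -> int) (n m j r : nat) :
  (0 < n)%N -> (forall i, (qfull q i %| n%:Z)%Z) -> (0 < r < m)%N ->
  height q (m * n) (j * m + r) = `|expo q n j|%N.
Proof.
by move=> n_gt0 q_dvd r_bounds; congr absz; apply: eq_bigr => i _;
  rewrite ceil_div_block.
Qed.

Lemma sum_Xn_height_mul (R : nzRingType) (k : nat) (q : 'I_k -> int)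
    (n m : nat) :
  (0 < n)%N -> (forall i, (qfull q i %| n%:Z)%Z) -> (0 < m)%N ->
  \sum_(0 <= a < m * n) 'X^(height q (m * n) a)
  = \sum_(0 <= j < n) 'X^(height q n j)
    + (\sum_(0 <= j < n) 'X^`|expo q n j|) *+ m.-1 :> {poly R}.
Proof.
move=> n_gt0 q_dvd m_gt0; rewrite {1}mulnC big_nat_mul -sumrMnl -big_split /=.
apply: eq_bigr => j _; rewrite -{1}[(j * m)%N]add0n big_addn mulSn addnK.
rewrite big_ltn // add0n height_mul //; congr (_ + _).
rewrite (eq_big_nat _ _ (F2 := fun=> 'X^`|expo q n j|)) => [|r r_bounds].
  by rewrite sumr_const_nat subn1.
by rewrite addnC height_block.
Qed.

Lemma mulX_L1 (R : realType) (k : nat) (q : 'I_k -> int) (n : nat) :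
  (0 < n)%N -> 'X * L1 R q n = \sum_(0 <= j < n) 'X^`|expo q n j|.
Proof.
move=> n_gt0; rewrite /L1 mulr_sumr; apply: eq_bigr => j _.
by rewrite -exprS; congr 'X^_; have := expo_gt0 q j n_gt0; lia.
Qed.

Theorem theorem5p1 (R : realType) (k : nat) (q : 'I_k -> int) (n : nat)
    (n_gt0 : (0 < n)%N)
    (q_dvd : forall i : 'I_k.+1, (qfull q i %| n%:Z)%Z) :
  (forall m : nat, (0 < m)%N ->
     hstar (@Delta0 R k (qvec q (m * n))) = m%:R *: ('X * L1 R q n) + L2 R q n)
  /\
  (forall M1 M2 : {poly R},
     (forall m : nat, (0 < m)%N ->
        hstar (@Delta0 R k (qvec q (m * n))) = m%:R *: ('X * M1) + M2) ->
     M1 = L1 R q n /\ M2 = L2 R q n).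
Proof.
have hstarE m : (0 < m)%N ->
    hstar (@Delta0 R k (qvec q (m * n))) = m%:R *: ('X * L1 R q n) + L2 R q n.
  move=> m_gt0; rewrite mulX_L1 // /L2 !hstar_Delta0 ?muln_gt0 ?m_gt0 //.
  rewrite sum_Xn_height_mul // scaler_nat -[in RHS](prednK m_gt0) mulrSr.
  by rewrite addrACA subrr addr0 addrC.
split=> // M1 M2 hstarM.
have eqM m : (0 < m)%N ->
    ('X * M1) *+ m + M2 = ('X * L1 R q n) *+ m + L2 R q n.
  by move=> m_gt0; rewrite -!scaler_nat -hstarM // hstarE.
have [/mulfI eqM1 ->] := mulrnDr_inj eqM.
by rewrite eqM1 // polyX_eq0.
Qed.
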